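(* Let $m$ be a large positive integer, let $k$ and $N$ be positive integers, and let $I=[1,N]$. Then the number $J_{2k}$ of solutions of the congruence $$x_1^*+\ldots+x_k^*\equiv x_{k+1}^*+\ldots+x_{2k}^*\pmod m$$ in integers $x_1,\ldots,x_{2k}\in I$ coprime to $m$ satisfies $$J_{2k}<(2k)^{90k^3}(\log N)^{4k^2}\Bigl(\frac{N^{2k-1}}{m}+1\Bigr)N^{k}.$$
   Context: For an integer $x$ coprime to $m$, $x^*$ denotes the multiplicative inverse of $x$ modulo $m$. $\log$ is the natural logarithm.
   Formalization: The formal statement requires N ≥ 2 instead of N positive: at N = 1 the right-hand side is 0 because log 1 = 0, while J_{2k} = 1 (all x_i = 1), so the bound as stated fails there. *)

(* Defs.v *)
From HB Require Import structures.
From mathcomp Require Import all_boot all_order all_algebra.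
From mathcomp Require Import all_classical all_reals all_analysis.
Set Implicit Arguments.
Unset Strict Implicit.
Unset Printing Implicit Defensive.
Import Order.TTheory GRing.Theory Num.Theory.
Local Open Scope ring_scope.

(* The variables x_1, ..., x_{2k} are x 0, ..., x (2k-1).  The inverse is
   taken in 'Z_m, which is the ring of residues modulo m only for 1 < m, and
   it is the modular inverse there only because x i is coprime to m. *)
Definition reciprocal_solutions (m k N : nat) :
    {set {ffun 'I_(2 * k) -> 'I_N.+1}} :=
  [set x : {ffun 'I_(2 * k) -> 'I_N.+1} |
    [forall i, (0 < x i)%N && coprime (x i) m] &&
    (\sum_(i < 2 * k | (i < k)%N) ((x i)%:R : 'Z_m)^-1 ==
     \sum_(i < 2 * k | (k <= i)%N) ((x i)%:R : 'Z_m)^-1)].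

Definition J (m k N : nat) : nat := #|reciprocal_solutions m k N|.

(* Main.v *)
(* Write the sum of the reciprocals of x_1, ..., x_k as a fraction u / v with
   v = x_1 ... x_k, so that u <= U = k N^(k-1) and v <= V = N^k.  If two
   distinct fractions agree modulo m, then m divides the nonzero integer
   u v' - u' v; hence the fractions below U / V are (m / V^2)-separated, the
   reciprocals of those above are (m / U^2)-separated, and a residue class
   contains at most 2 (U V / m + 1) of them.  By Cauchy-Schwarz, J is at most
   this number times the number of solutions of the equation over the rationals.

   In a rational solution no prime divides the product of all 2k variables
   exactly once.  Grouping prime factors two or three at a time,
   x_i = prod_s g_s^(e(s, i)) where s ranges over pairs and triples of indices,
   and prod_s g_s^(deg s) <= N^(2k).  Rankin's trick bounds the number of such g
   by N^k (sum_(j <= N) 1/j)^(4k^2) (sum_(j <= N) j^(-3/2))^(8k^3). *)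
Require Import Defs.
From HB Require Import structures.
From mathcomp Require Import all_boot all_order all_algebra.
From mathcomp Require Import all_classical all_reals all_analysis.
From mathcomp Require Import zify ring lra.
Set Implicit Arguments.
Unset Strict Implicit.
Unset Printing Implicit Defensive.
Import Order.TTheory GRing.Theory Num.Theory.
Local Open Scope nat_scope.

(** * Collisions of a map and Cauchy-Schwarz *)

Lemma card_fibered_pairs (T V : finType) (A : {set T}) (f : T -> V) :
  #|[set p in finset.setX A A | f p.1 == f p.2]| = \sum_v #|[set y in A | f y == v]| ^ 2.
Proof.
rewrite -sum1_card (partition_big (fun p : T * T => f p.1) xpredT) //=.
apply: eq_bigr => v _; rewrite -mulnn -cardsX -sum1_card; apply: eq_bigl => p.
rewrite !inE; case: (p.1 \in A); case: (p.2 \in A) => //=; rewrite ?andbF //.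
by case: (f p.1 =P v) => [->|]; rewrite ?andbT ?andbF //= eq_sym.
Qed.

Lemma sqr_sum_nat (I : finType) (D : {set I}) (t : I -> nat) :
  (\sum_(i in D) t i) ^ 2 <= #|D| * \sum_(i in D) t i ^ 2.
Proof.
rewrite -(leq_pmul2l (isT : 0 < 2)) -mulnn big_distrlr /= big_distrr /=.
have -> : 2 * (#|D| * \sum_(i in D) t i ^ 2) =
    \sum_(i in D) \sum_(j in D) (t i ^ 2 + t j ^ 2).
  under [RHS]eq_bigr do rewrite big_split /= sum_nat_const.
  by rewrite big_split /= sum_nat_const -big_distrr /=; lia.
apply: leq_sum => i _; rewrite big_distrr /=.
by apply: leq_sum => j _; case: (nat_Cauchy (t i) (t j)).
Qed.

(* Cauchy-Schwarz on each fibre of [f], cut into fibres of [h]. *)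
Lemma collision_bound (T V : finType) (W : eqType) (A : {set T})
    (f : T -> V) (h : T -> W) (B : nat) :
  (forall C : {set T}, C \subset A -> {in C &, forall a b, f a = f b} ->
     {in C &, injective h} -> #|C| <= B) ->
  #|[set p in finset.setX A A | f p.1 == f p.2]| <=
  B * #|[set p in finset.setX A A | h p.1 == h p.2]|.
Proof.
move=> HB.
(* [r v y] is a canonical representative of the [h]-class of [y] inside the fibre of [f] over [v].
   The representatives form a set on which [f] is constant and [h] injective, so [HB] bounds their
   number. *)
pose r v y := choose [pred z | [&& z \in A, f z == v & h z == h y]] y.
have rP v y : y \in A -> f y == v ->
    [/\ r v y \in A, f (r v y) == v & h (r v y) == h y].
  move=> yA fy; apply/and3P.
  apply: (chooseP (P := [pred z | [&& z \in A, f z == v & h z == h y]])).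
  by rewrite /= yA fy eqxx.
have rE v y z : y \in A -> f y == v -> z \in A -> f z == v ->
    (r v y == r v z) = (h y == h z).
  move=> yA fy zA fz; apply/eqP/eqP => [e|e].
    have [_ _ /eqP <-] := rP v y yA fy; rewrite e.
    by have [_ _ /eqP ->] := rP v z zA fz.
  rewrite /r (eq_choose (Q := [pred w | [&& w \in A, f w == v & h w == h z]])); last first.
    by move=> w /=; rewrite e.
  by apply: choose_id; rewrite /= ?yA ?zA ?fy ?fz ?e eqxx.
rewrite card_fibered_pairs.
apply: (@leq_trans (\sum_v B * #|[set p in finset.setX A A |
    (f p.1 == v) && (f p.2 == v) && (h p.1 == h p.2)]|)); last first.
  rewrite -big_distrr leq_mul2l; apply/orP; right.
  rewrite -[leqRHS]sum1_card (partition_big (fun p : T * T => f p.1) xpredT) //=.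
  apply: leq_sum => v _; rewrite sum1_card; apply/subset_leq_card/fintype.subsetP => p.
  rewrite !inE => /andP[/andP[p1 p2] /andP[/andP[fp _] hp]].
  by rewrite unfold_in /= !inE p1 p2 fp hp.
apply: leq_sum => v _; set Y := [set y in A | f y == v].
have -> : #|Y| = \sum_(w in r v @: Y) #|[set y in Y | r v y == w]|.
  rewrite -sum1_card (partition_big (r v) [in r v @: Y]) /=; last first.
    by move=> i iY; apply: imset_f.
  by apply: eq_bigr => w _; rewrite -sum1_card; apply: eq_bigl => y; rewrite !inE.
apply: leq_trans (sqr_sum_nat _ _) _; apply: leq_mul.
  apply: HB.
  - apply/fintype.subsetP => _ /imsetP[y + ->]; rewrite inE => /andP[yA fy].
    by have [] := rP v y yA fy.
  - move=> _ _ /imsetP[y + ->] /imsetP[z + ->]; rewrite !inE.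
    move=> /andP[yA fy] /andP[zA fz].
    have [_ /eqP -> _] := rP v y yA fy.
    by have [_ /eqP -> _] := rP v z zA fz.
  - move=> _ _ /imsetP[y + ->] /imsetP[z + ->]; rewrite !inE.
    move=> /andP[yA fy] /andP[zA fz].
    have [_ _ /eqP ->] := rP v y yA fy.
    have [_ _ /eqP ->] := rP v z zA fz.
    by move/eqP; rewrite -(rE v) // => /eqP.
apply: (@leq_trans (\sum_w #|[set y in Y | r v y == w]| ^ 2)).
  by rewrite [leqRHS](bigID [in r v @: Y]) /= leq_addr.
rewrite -card_fibered_pairs; apply/subset_leq_card/fintype.subsetP => -[y z].
rewrite !inE /= => /andP[/andP[/andP[yA fy] /andP[zA fz]] e].
by rewrite yA zA fy fz -(rE v).
Qed.

(** * Separation of fractions that agree modulo [m] *)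

(** Distinct fractions differ by at least [m / (v a * v b)], hence by [m / V ^ 2]. So [q a], the
    integer part of [(u a / v a) / (m / V ^ 2)], is injective, and it is at most [U * V / m] because
    [u a / v a] is at most [U / V]. *)
Lemma separated_ratios_low (T : finType) (C : {set T}) (u v : T -> nat)
    (m U V : nat) :
  0 < m ->
  {in C, forall a, 0 < v a <= V} -> {in C, forall a, u a * V <= U * v a} ->
  {in C &, forall a b, u a * v b = u b * v a %[mod m]} ->
  {in C &, forall a b, u a * v b = u b * v a -> a = b} ->
  #|C| <= ((U * V) %/ m).+1.
Proof.
move=> m0 Hv Huv Hm Hi; pose q a := (u a * V * V) %/ (v a * m).
have qle a : a \in C -> q a < ((U * V) %/ m).+1.
  move=> aC; have /andP[va0 vaV] := Hv _ aC.
  rewrite ltnS /q -(@divnMl (v a) (U * V) m) //; apply: leq_div2r.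
  by rewrite mulnA [v a * U]mulnC leq_mul2r Huv ?orbT.
have qlt a b : a \in C -> b \in C -> u b * v a < u a * v b -> q b < q a.
  move=> aC bC lt; have /andP[va0 vaV] := Hv _ aC; have /andP[vb0 vbV] := Hv _ bC.
  rewrite /q leq_divRL ?muln_gt0 ?va0 //.
  have sep : u b * v a + m <= u a * v b.
    have : m %| u a * v b - u b * v a.
      by rewrite -eqn_mod_dvd ?(ltnW lt) // eq_sym; apply/eqP/Hm.
    by move/dvdn_leq; rewrite subn_gt0 => /(_ lt); lia.
  have := leq_divM (u b * V * V) (v b * m); rewrite -/(q b) => Hq.
  rewrite -(leq_pmul2r vb0).
  apply: (@leq_trans (V * V * (u b * v a + m))); last first.
    by apply: leq_trans (leq_mul (leqnn (V * V)) sep) _; nia.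
  have h1 := leq_mul Hq (leqnn (v a)).
  have h2 := leq_mul (leq_mul vaV vbV) (leqnn m).
  by nia.
have qinj : {in C &, injective q}.
  move=> a b aC bC e; apply: Hi => //.
  case: (ltngtP (u a * v b) (u b * v a)) => // lt.
    by have := qlt b a bC aC lt; rewrite e ltnn.
  by have := qlt a b aC bC lt; rewrite e ltnn.
have : #|[set (inord (q a) : 'I_((U * V) %/ m).+1) | a in C]| = #|C|.
  apply: card_in_imset => a b aC bC /(congr1 val).
  by rewrite /= !inordK ?qle //; apply: qinj.
by move=> <-; rewrite -[leqRHS]card_ord max_card.
Qed.

(** Above [U / V], exchange [u] and [v]: the reciprocals lie below [V / U], and the bound is
    symmetric in [U] and [V]. *)
Lemma separated_ratios (T : finType) (C : {set T}) (u v : T -> nat)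
    (m U V : nat) :
  0 < m ->
  {in C, forall a, 0 < u a <= U} -> {in C, forall a, 0 < v a <= V} ->
  {in C &, forall a b, u a * v b = u b * v a %[mod m]} ->
  {in C &, forall a b, u a * v b = u b * v a -> a = b} ->
  #|C| <= 2 * ((U * V) %/ m).+1.
Proof.
move=> m0 Hu Hv Hm Hi; pose L := [set a | u a * V <= U * v a].
rewrite -(cardsID L C) mul2n -addnn; apply: leq_add.
  apply: (@separated_ratios_low _ _ u v) => //.
  - by move=> a; rewrite inE => /andP[/Hv].
  - by move=> a; rewrite !inE => /andP[].
  - by move=> a b; rewrite !inE => /andP[aC _] /andP[bC _]; apply: Hm.
  - by move=> a b; rewrite !inE => /andP[aC _] /andP[bC _]; apply: Hi.
rewrite [U * V]mulnC; apply: (@separated_ratios_low _ _ v u) => //.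
- by move=> a; rewrite inE => /andP[_ /Hu].
- by move=> a; rewrite !inE -ltnNge => /andP[/ltnW + _]; lia.
- move=> a b; rewrite !inE => /andP[_ aC] /andP[_ bC].
  by rewrite mulnC [v b * _]mulnC; apply/esym/Hm.
- move=> a b; rewrite !inE => /andP[_ aC] /andP[_ bC] e.
  by apply: Hi => //; lia.
Qed.

(** * Sums of reciprocals as fractions *)

Section Fractions.
Variable I : finType.
Implicit Type y : I -> nat.

(* [\sum_i 1 / y i] is the fraction [recip_num y / recip_den y]. *)
Definition recip_den y := \prod_i y i.
Definition recip_num y := \sum_i \prod_(j | j != i) y j.

Lemma recip_den_bounds N y :
  (forall i, 0 < y i <= N) -> 0 < recip_den y <= N ^ #|I|.
Proof.
move=> Hy; rewrite prodn_gt0 => [|i]; last by case/andP: (Hy i).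
rewrite -prod_nat_const; apply: leq_prod => i _; by case/andP: (Hy i).
Qed.

Lemma recip_num_bounds N y : 0 < #|I| ->
  (forall i, 0 < y i <= N) -> 0 < recip_num y <= #|I| * N ^ #|I|.-1.
Proof.
move=> I0 Hy; have P0 i : 0 < \prod_(j | j != i) y j.
  by rewrite prodn_cond_gt0 // => j _; case/andP: (Hy j).
apply/andP; split.
  by have /card_gt0P[i _] := I0; rewrite /recip_num (bigD1 i) //= addn_gt0 P0.
rewrite -sum_nat_const; apply: leq_sum => i _.
have <- : #|predC1 i| = #|I|.-1 by rewrite cardC1.
rewrite -prod_nat_const; apply: leq_prod => j _; by case/andP: (Hy j).
Qed.

Lemma recip_num_Zp m y : 1 < m -> (forall i, coprime (y i) m) ->
  ((recip_num y)%:R = (recip_den y)%:R * \sum_i ((y i)%:R)^-1 :> 'Z_m)%R.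
Proof.
move=> m1 cy; rewrite natr_sum mulr_sumr; apply: eq_bigr => i _.
rewrite [recip_den y](bigD1 i) //= natrM mulrAC divrr ?mul1r //.
by rewrite unitZpE // coprime_sym.
Qed.

(** If [p] divides [y i], it divides every term of the numerator except perhaps the [i]-th, hence
    that one too. This term is the product of the other entries, which supplies the second factor
    [p]. *)
Lemma dvd_recip_num p y : prime p -> p %| recip_den y -> p %| recip_num y ->
  p ^ 2 %| recip_den y.
Proof.
move=> pp; rewrite {1}/recip_den Euclid_dvd_prod // big_orE => /existsP[i /= pi].
rewrite /recip_num (bigD1 i) //= dvdn_addl; last first.
  apply: dvdn_sum => j ji; rewrite (bigD1 i) 1?eq_sym //=.
  by apply: dvdn_mulr.
by move=> h; rewrite /recip_den (bigD1 i) //= -mulnn dvdn_mul.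
Qed.
End Fractions.

(** * Factoring tuples with powerful product *)

Section PowerfulTuples.
Variable I : finType.
Implicit Type x : I -> nat.

(* Slots of degree 2 and 3 distribute the factors of a powerful number
   [a ^ 2 * b ^ 3] among the entries of a tuple. *)
Definition slot : finType := ((I * I) + (I * I * I))%type.

Definition slot_mult (s : slot) (i : I) : nat :=
  match s with
  | inl (a, b) => (a == i) + (b == i)
  | inr (a, b, c) => (a == i) + (b == i) + (c == i)
  end.

Definition slot_deg (s : slot) : nat := if s is inl _ then 2 else 3.

Lemma sum_slot_mult s : \sum_i slot_mult s i = slot_deg s.
Proof.
have d (a : I) : \sum_i (a == i : nat) = 1.
  by rewrite (bigD1 a) //= eqxx big1 // => i; rewrite eq_sym => /negPf ->.
by case: s => [[a b]|[[a b] c]]; rewrite !big_split /= !d.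
Qed.

Lemma extract_prime p x : prime p -> p %| \prod_i x i ->
  exists a x', (forall i, x i = x' i * p ^ (a == i)) /\
    \prod_i x i = p * \prod_i x' i.
Proof.
move=> pp; rewrite Euclid_dvd_prod // big_orE => /existsP[a /= pa].
exists a, (fun i => if a == i then x i %/ p else x i).
have e i : x i = (if a == i then x i %/ p else x i) * p ^ (a == i).
  by case: eqP => [<-|_]; rewrite ?muln1 // expn1 divnK.
split=> //; under eq_bigr do rewrite e.
rewrite big_split /= mulnC; congr (_ * _).
by rewrite (bigD1 a) //= eqxx expn1 big1 ?muln1 // => i; rewrite eq_sym => /negPf ->.
Qed.

Definition powerful n := forall p, prime p -> p %| n -> p ^ 2 %| n.

(** Induction on the product: strip two or three factors [p] from entries [a], [b], [c], possibly
    equal, so that the cofactor stays powerful, and multiply [p] into the corresponding slot. *)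
Lemma powerful_slots x : (forall i, 0 < x i) -> powerful (\prod_i x i) ->
  exists g : slot -> nat, forall i, x i = \prod_s g s ^ slot_mult s i.
Proof.
have [n] := ubnP (\prod_i x i); elim: n x => // n IHn x ltn x0 Px.
have step p s x' : prime p -> (forall i, x i = x' i * p ^ slot_mult s i) ->
    \prod_i x' i < n -> powerful (\prod_i x' i) ->
    exists g : slot -> nat, forall i, x i = \prod_s g s ^ slot_mult s i.
  move=> pp e ltx Px'; have [||g Hg] := IHn x' _ _ Px'; first exact: ltx.
    by move=> i; have := x0 i; rewrite e muln_gt0 => /andP[].
  exists (fun t => g t * p ^ (t == s)) => i; rewrite e Hg.
  under [RHS]eq_bigr do rewrite expnMn.
  rewrite big_split /=; congr (_ * _).
  rewrite (bigD1 s) //= eqxx expn1 big1 ?muln1 // => t /negPf ->.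
  by rewrite expn0 exp1n.
have [x1|nx1] := eqVneq (\prod_i x i) 1.
  exists (fun=> 1) => i; rewrite big1 => [|s _]; last by rewrite exp1n.
  by apply/eqP; rewrite -dvdn1 -x1 (bigD1 i) //= dvdn_mulr.
have P0 : 0 < \prod_i x i by apply: prodn_gt0.
set p := pdiv (\prod_i x i); have pp : prime p by rewrite pdiv_prime; lia.
have p0 := prime_gt0 pp; have p1 := prime_gt1 pp.
have pP : p %| \prod_i x i by apply: pdiv_dvd.
have pP2 := Px p pp pP.
have [a [xa [ea eaP]]] := extract_prime pp pP.
have pA : p %| \prod_i xa i by move: pP2; rewrite eaP -mulnn dvdn_pmul2l.
have [b [xb [eb ebP]]] := extract_prime pp pA.
have Q0 : 0 < \prod_i xb i.
  by move: P0; rewrite eaP ebP !muln_gt0 => /and3P[].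
have away q : prime q -> q != p -> q %| \prod_i xb i -> q ^ 2 %| \prod_i xb i.
  move=> qp qnp qd.
  have := Px q qp; rewrite eaP ebP mulnA mulnn (@Gauss_dvdr (q ^ 2)).
    by apply; apply: dvdn_mull.
  by rewrite coprimeXl // coprimeXr // prime_coprime // dvdn_prime2.
(* After two factors [p] are removed, the cofactor is still powerful unless exactly one [p] remains;
   only then is a slot of degree 3 used. *)
have [pB|pnB] := boolP (p %| \prod_i xb i); last first.
  apply: (step p (inl (a, b)) xb) => //.
  - by move=> i; rewrite ea eb /= expnD; lia.
  - by move: ltn; rewrite eaP ebP; nia.
  - move=> q qp; have [->|qnp] := eqVneq q p; first by rewrite (negPf pnB).
    exact: away.
have [pB2|pnB2] := boolP (p ^ 2 %| \prod_i xb i).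
  apply: (step p (inl (a, b)) xb) => //.
  - by move=> i; rewrite ea eb /= expnD; lia.
  - by move: ltn; rewrite eaP ebP; nia.
  - move=> q qp; have [->|qnp] := eqVneq q p; first by rewrite pB2.
    exact: away.
have [c [xc [ec ecP]]] := extract_prime pp pB.
apply: (step p (inr (a, b, c)) xc) => //.
- by move=> i; rewrite ea eb ec /= !expnD; lia.
- by move: ltn Q0; rewrite eaP ebP ecP muln_gt0 => ? /andP[_ ?]; nia.
- move=> q qp; have [->|qnp] := eqVneq q p.
    by move: pnB2; rewrite ecP -mulnn dvdn_pmul2l // => /negPf ->.
  move=> qd; have := away q qp qnp; rewrite ecP (@Gauss_dvdr (q ^ 2)); last first.
    by rewrite coprimeXl // prime_coprime // dvdn_prime2.
  by apply; apply: dvdn_mull.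
Qed.

End PowerfulTuples.

Local Open Scope ring_scope.

(** * Estimates for the two Rankin sums *)

Section RealBounds.
Variable R : realType.

Lemma inv_succ_le_ln (n : nat) : (0 < n)%N ->
  (n.+1%:R)^-1 <= ln n.+1%:R - ln n%:R :> R.
Proof.
move=> n0; have p0 : 0 < n%:R :> R by rewrite ltr0n.
have p1 : 0 < n.+1%:R :> R by rewrite ltr0n.
have h : -1 < - (n.+1%:R)^-1 :> R.
  by rewrite ltrN2 invf_lt1 // -[1]/(1%:R) ltr_nat.
have := le_ln1Dx h.
have -> : 1 + - (n.+1%:R)^-1 = n%:R / n.+1%:R :> R.
  by rewrite -natr1; field; rewrite natr1 gt_eqF.
by rewrite ln_div // lerNr opprB.
Qed.

(* The term [j = 0] vanishes because [0^-1 = 0]; likewise in the next sum. *)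
Lemma harmonic_sum_le (N : nat) : (0 < N)%N ->
  \sum_(j < N.+1) (Num.sqrt j%:R) ^- 2 <= 1 + ln N%:R :> R.
Proof.
elim: N => // -[|N] IHN _.
  by rewrite !big_ord_recr big_ord0 /= sqrtr0 sqrtr1 ln1 expr0n invr0 expr1n invr1; lra.
rewrite big_ord_recr /= sqr_sqrtr ?ler0n //.
apply: le_trans (lerD (IHN isT) (@inv_succ_le_ln N.+1 isT)) _.
by rewrite -addrA subrKC.
Qed.

Lemma cube_sqrt_sum_le (N : nat) :
  \sum_(j < N.+1) (Num.sqrt j%:R) ^- 3 <= 3 :> R.
Proof.
case: N => [|N].
  by rewrite big_ord_recr big_ord0 /= sqrtr0 expr0n invr0; lra.
(* The correction [2 / sqrt n], from the integral of [t^(-3/2)], makes the induction telescope. *)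
suff : \sum_(j < N.+2) (Num.sqrt j%:R) ^- 3 <= 3 - 2 / Num.sqrt N.+1%:R :> R.
  by move/le_trans; apply; rewrite gerBl divr_ge0 // sqrtr_ge0.
elim: N => [|N IHN].
  by rewrite !big_ord_recr big_ord0 /= sqrtr0 sqrtr1 expr0n invr0 expr1n invr1; lra.
rewrite big_ord_recr /=.
set a := Num.sqrt N.+1%:R in IHN; set b := Num.sqrt N.+2%:R.
have a0 : 0 < a by rewrite sqrtr_gt0 ltr0n.
have b0 : 0 < b by rewrite sqrtr_gt0 ltr0n.
have a2 : a ^+ 2 = N.+1%:R by rewrite sqr_sqrtr.
have b2 : b ^+ 2 = a ^+ 2 + 1 by rewrite sqr_sqrtr // a2 natr1.
have ab : a <= b by rewrite ler_sqrt ?ler_nat.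
(* Since [(b - a) * (a + b) = 1], this is the increment of the bound; it dominates [b ^- 3] because
   [a <= b]. *)
have -> : 3 - 2 / b = 3 - 2 / a + 2 / (a * b * (a + b)).
  have -> : 2 / (a * b * (a + b)) = 2 * ((b - a) * (a + b)) / (a * b * (a + b)).
    have -> : (b - a) * (a + b) = 1 by nra.
    by rewrite mulr1.
  by field; rewrite !gt_eqF // addr_gt0.
apply: lerD; rewrite // -[b ^- 3]mul1r ler_pdivrMr ?exprn_gt0 // mulrAC.
rewrite ler_pdivlMr ?mulr_gt0 ?addr_gt0 //.
by nra.
Qed.
End RealBounds.

(** * Counting powerful tuples *)

Lemma prod_slot_expn (I : finType) (g : slot I -> nat) :
  (\prod_i \prod_s g s ^ slot_mult s i = \prod_s g s ^ slot_deg s)%N.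
Proof.
rewrite exchange_big /=; apply: eq_bigr => s _.
by rewrite -sum_slot_mult (big_morph _ (expnD (g s)) (expn0 (g s))).
Qed.

Lemma slot_mult_gt0 (I : finType) (s : slot I) : exists i, (0 < slot_mult s i)%N.
Proof. by case: s => [[a b]|[[a b] c]]; exists a; rewrite /= eqxx. Qed.

(* Rankin's trick: every admissible family [g] of factors has
   [\prod_s g s ^ slot_deg s <= N ^ #|I|], so it contributes at least 1 to the
   right-hand side after the product of sums is expanded. *)
Lemma card_powerful_tuples (R : realType) (I : finType) (N : nat)
    (X : {set {ffun I -> 'I_N.+1}}) :
  {in X, forall x : {ffun I -> 'I_N.+1}, (forall i, 0 < x i)%N /\ powerful (\prod_i x i)} ->
  #|X|%:R <= Num.sqrt N%:R ^+ #|I| *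
    \prod_(s : slot I) \sum_(j < N.+1) (Num.sqrt j%:R) ^- slot_deg s :> R.
Proof.
move=> HX.
pose G := [set g : {ffun slot I -> 'I_N.+1} |
  [forall s, 0 < g s]%N && (\prod_s g s ^ slot_deg s <= N ^ #|I|)%N].
pose Phi (g : {ffun slot I -> 'I_N.+1}) : {ffun I -> 'I_N.+1} :=
  [ffun i => inord (\prod_s g s ^ slot_mult s i)].
(* Factorizations need not be unique; it suffices that [Phi] covers [X]. Products above [N], which
   [inord] sends to 0, do no harm. *)
have XG : (#|X| <= #|G|)%N.
  suff /subset_leq_card/leq_trans : X \subset Phi @: G.
    by apply; apply: leq_imset_card.
  apply/fintype.subsetP => x /HX[x0 /(powerful_slots x0)[g Hg]].
  have gdvd s : exists i, (g s %| x i)%N.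
    have [i si] := slot_mult_gt0 s; exists i; rewrite Hg (bigD1 s) //=.
    by rewrite dvdn_mulr // dvdn_exp.
  have g0 s : (0 < g s)%N by have [i] := gdvd s; apply: dvdn_gt0.
  have gN s : (g s < N.+1)%N.
    have [i /(dvdn_leq (x0 i)) /leq_ltn_trans] := gdvd s; apply.
    exact: ltn_ord.
  pose h : {ffun slot I -> 'I_N.+1} := [ffun s => inord (g s)].
  have hE s : h s = g s :> nat by rewrite ffunE inordK.
  apply/imsetP; exists h.
    rewrite inE; apply/andP; split; first by apply/forallP => s; rewrite hE.
    under eq_bigr do rewrite hE.
    rewrite -prod_slot_expn -prod_nat_const; apply: leq_prod => i _.
    by rewrite -Hg -ltnS ltn_ord.
  apply/ffunP => i; apply: val_inj; rewrite ffunE /= inordK.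
    by rewrite Hg; apply: eq_bigr => s _; rewrite hE.
  under eq_bigr do rewrite hE.
  by rewrite -Hg.
apply: (@le_trans _ _ #|G|%:R); first by rewrite ler_nat.
rewrite bigA_distr_bigA /= -[#|G|]sum1_card natr_sum mulr_sumr.
rewrite [leRHS](bigID [in G]) /= -[leLHS]addr0; apply: lerD; last first.
  apply: sumr_ge0 => g _; rewrite mulr_ge0 ?exprn_ge0 ?sqrtr_ge0 //.
  by apply: prodr_ge0 => s _; rewrite invr_ge0 exprn_ge0 ?sqrtr_ge0.
apply: ler_sum => g; rewrite inE => /andP[/forallP g0 gN].
rewrite prodfV -[leRHS]/(_ / _).
have sq0 s : 0 < Num.sqrt (g s)%:R :> R by rewrite sqrtr_gt0 ltr0n g0.
rewrite ler_pdivlMr ?mul1r; last by apply: prodr_gt0 => s _; rewrite exprn_gt0.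
(* Squaring turns the claim into the integer inequality [gN]. *)
have le2 : (\prod_s Num.sqrt (g s)%:R ^+ slot_deg s) ^+ 2 <= (Num.sqrt N%:R ^+ #|I|) ^+ 2 :> R.
  rewrite -prodrXl.
  under eq_bigr do rewrite exprAC sqr_sqrtr // -natrX.
  by rewrite exprAC sqr_sqrtr // -natrX -natr_prod ler_nat.
rewrite -(@ler_pXn2r _ 2) // nnegrE ?exprn_ge0 ?sqrtr_ge0 //.
by apply: prodr_ge0 => s _; rewrite exprn_ge0 // ltW.
Qed.

Lemma prod_slot_sums_le (R : realType) (I : finType) (N : nat) : (0 < N)%N ->
  \prod_(s : slot I) \sum_(j < N.+1) (Num.sqrt j%:R) ^- slot_deg s <=
  (1 + ln N%:R) ^+ (#|I| ^ 2) * 3 ^+ (#|I| ^ 3) :> R.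
Proof.
move=> N0; rewrite big_sumType /=.
have s0 d : 0 <= \sum_(j < N.+1) (Num.sqrt j%:R) ^- d :> R.
  by apply: sumr_ge0 => j _; rewrite invr_ge0 exprn_ge0 ?sqrtr_ge0.
rewrite !prodr_const !card_prod mulnn -expnSr.
apply: ler_pM; rewrite ?exprn_ge0 //; apply: lerXn2r; rewrite ?nnegrE //.
- by rewrite addr_ge0 // ln_ge0 // ler1n.
- exact: harmonic_sum_le.
- exact: cube_sqrt_sum_le.
Qed.

(** * Solutions of the rational equation *)

(** Both sides are joined into one tuple because a slot may distribute its factor across the two
    sides. *)
Definition pair_tuple (k N : nat) (p : {ffun 'I_k -> 'I_N.+1} * {ffun 'I_k -> 'I_N.+1}) :
    {ffun 'I_k + 'I_k -> 'I_N.+1} :=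
  [ffun i => match i with inl a => p.1 a | inr b => p.2 b end].

Lemma pair_tuple_inj k N : injective (@pair_tuple k N).
Proof.
move=> [y z] [y' z'] /ffunP e; congr pair; apply/ffunP => i.
  by have := e (inl i); rewrite !ffunE.
by have := e (inr i); rewrite !ffunE.
Qed.

Lemma prod_pair_tuple k N p :
  (\prod_i (@pair_tuple k N p) i = recip_den (fun i => p.1 i) * recip_den (fun i => p.2 i))%N.
Proof.
by rewrite big_sumType /=; congr (_ * _)%N; apply: eq_bigr => i _; rewrite ffunE.
Qed.

(** If [p] divides both denominators, their product contains [p ^ 2]. If it divides only one, the
    equation forces it into the numerator over that one, and [dvd_recip_num] applies. *)
Lemma powerful_recip_eq (I : finType) (y z : I -> nat) :
  (recip_num y * recip_den z = recip_num z * recip_den y)%N ->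
  powerful (recip_den y * recip_den z).
Proof.
have half (y' z' : I -> nat) p : prime p ->
    (recip_num y' * recip_den z' = recip_num z' * recip_den y')%N ->
    (p %| recip_den y')%N -> (p ^ 2 %| recip_den y' * recip_den z')%N.
  move=> pp e py; have [pz|pnz] := boolP (p %| recip_den z')%N.
    by rewrite -mulnn dvdn_mul.
  apply/dvdn_mulr/dvd_recip_num => //.
  have : (p %| recip_num y' * recip_den z')%N by rewrite e dvdn_mull.
  by rewrite Euclid_dvdM // (negPf pnz) orbF.
move=> e p pp; rewrite Euclid_dvdM // => /orP[|pz]; first exact: half.
by rewrite mulnC; apply: half.
Qed.

Lemma card_recip_eq (R : realType) (k N : nat)
    (A : {set {ffun 'I_k -> 'I_N.+1}}) : (0 < N)%N ->
  {in A, forall (y : {ffun 'I_k -> 'I_N.+1}) i, 0 < y i}%N ->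
  #|[set p in finset.setX A A | recip_num (fun i => p.1 i) * recip_den (fun i => p.2 i) ==
                         recip_num (fun i => p.2 i) * recip_den (fun i => p.1 i)]%N|%:R <=
  N%:R ^+ k * ((1 + ln N%:R) ^+ (4 * k ^ 2) * 3 ^+ (8 * k ^ 3)) :> R.
Proof.
move=> N0 HA; set P := [set p in _ | _].
rewrite -(card_imset _ (@pair_tuple_inj k N)).
apply: le_trans (card_powerful_tuples _ _) _.
  move=> _ /imsetP[p + ->]; rewrite !inE => /andP[/andP[p1 p2] /eqP e].
  split=> [i|]; last by rewrite prod_pair_tuple; apply: powerful_recip_eq.
  by rewrite ffunE; case: i => i; [apply: (HA _ p1)|apply: (HA _ p2)].
have -> : Num.sqrt N%:R ^+ #|{: ('I_k + 'I_k)%type}| = N%:R ^+ k :> R.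
  by rewrite card_sum card_ord addnn -mul2n exprM sqr_sqrtr.
rewrite ler_wpM2l ?exprn_ge0 //.
apply: le_trans (prod_slot_sums_le _ _ N0) _.
by rewrite card_sum card_ord addnn -mul2n !expnMn.
Qed.

(** * From the congruence to the rational equation *)

Definition coprime_tuples (m k N : nat) : {set {ffun 'I_k -> 'I_N.+1}} :=
  [set y : {ffun 'I_k -> 'I_N.+1} | [forall i, (0 < y i)%N && coprime (y i) m]].

Definition recip_residue (m k N : nat) (y : {ffun 'I_k -> 'I_N.+1}) : 'Z_m :=
  \sum_i ((y i)%:R)^-1.

Lemma sum_split_halves (V : nmodType) (n k : nat) (e : n = (k + k)%N)
    (F : 'I_n -> V) :
  \sum_(i < n | (i < k)%N) F i = \sum_i F (cast_ord (esym e) (lshift k i)) /\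
  \sum_(i < n | (k <= i)%N) F i = \sum_i F (cast_ord (esym e) (rshift k i)).
Proof.
case: _ / (esym e) F => F; split; rewrite big_mkcond big_split_ord /=.
  rewrite [X in _ + X]big1 ?addr0 => [|i _]; last by rewrite ltnNge leq_addr.
  by apply: eq_bigr => i _; rewrite cast_ord_id ltn_ord.
rewrite [X in X + _]big1 ?add0r => [|i _]; last by rewrite leqNgt ltn_ord.
by apply: eq_bigr => i _; rewrite cast_ord_id leq_addr.
Qed.

Lemma J_le_collisions (m k N : nat) :
  (J m k N <= #|[set p in finset.setX (coprime_tuples m k N) (coprime_tuples m k N) |
                 recip_residue m p.1 == recip_residue m p.2]|)%N.
Proof.
have e : (2 * k = k + k)%N by lia.
pose lo i := cast_ord (esym e) (lshift k i).
pose hi i := cast_ord (esym e) (rshift k i).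
pose h (x : {ffun 'I_(2 * k) -> 'I_N.+1}) :=
  ([ffun i => x (lo i)] : {ffun 'I_k -> 'I_N.+1},
   [ffun i => x (hi i)] : {ffun 'I_k -> 'I_N.+1}).
have h_inj : injective h.
  move=> x x' [/ffunP el /ffunP eh]; apply/ffunP => i.
  rewrite -(cast_ordK e i); case: (fintype.split_ordP (cast_ord e i)) => j ->.
    by have := el j; rewrite !ffunE.
  by have := eh j; rewrite !ffunE.
rewrite /J -(card_imset _ h_inj); apply/subset_leq_card/fintype.subsetP => _ /imsetP[x + ->].
rewrite !inE => /andP[/forallP xP].
have [-> ->] := sum_split_halves e (fun i => ((x i)%:R : 'Z_m)^-1).
move=> /eqP eq; apply/andP; split.
  by apply/andP; split; apply/forallP => i; rewrite ffunE.
rewrite /recip_residue /=; apply/eqP.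
under eq_bigr do rewrite ffunE; under [RHS]eq_bigr do rewrite ffunE.
exact: eq.
Qed.

(** [collision_bound] compares residues ([f]) with exact rational values ([h]); [separated_ratios]
    supplies its constant with [U = k * N ^ k.-1] and [V = N ^ k]. *)
Lemma J_le_recip_eq (m k N : nat) : (1 < m)%N -> (0 < k)%N ->
  (J m k N <= 2 * ((k * N ^ k.-1 * N ^ k) %/ m).+1 *
    #|[set p in finset.setX (coprime_tuples m k N) (coprime_tuples m k N) |
       recip_num (fun i => p.1 i) * recip_den (fun i => p.2 i) ==
       recip_num (fun i => p.2 i) * recip_den (fun i => p.1 i)]|)%N.
Proof.
move=> m1 k0; set A := coprime_tuples m k N.
pose num (y : {ffun 'I_k -> 'I_N.+1}) := recip_num (fun i => y i).
pose den (y : {ffun 'I_k -> 'I_N.+1}) := recip_den (fun i => y i).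
pose ratio y : rat := (num y)%:R / (den y)%:R.
have bnd y : y \in A -> forall i, (0 < y i <= N)%N.
  by rewrite inE => /forallP yP i; have /andP[-> _] := yP i; rewrite -ltnS ltn_ord.
have den_b y : y \in A -> (0 < den y <= N ^ k)%N.
  by move/bnd/recip_den_bounds; rewrite card_ord.
have num_b y : y \in A -> (0 < num y <= k * N ^ k.-1)%N.
  move/bnd/recip_num_bounds; rewrite card_ord; exact.
have ratioE y z : y \in A -> z \in A ->
    (ratio y == ratio z) = (num y * den z == num z * den y)%N.
  move=> /den_b/andP[dy _] /den_b/andP[dz _].
  by rewrite /ratio eqr_div ?pnatr_eq0 -?lt0n // -!natrM eqr_nat.
apply: leq_trans (J_le_collisions _ _ _) _.
apply: leq_trans (@collision_bound _ _ _ A (@recip_residue m k N) ratio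
  (2 * ((k * N ^ k.-1 * N ^ k) %/ m).+1) _) _; last first.
  rewrite leq_mul2l; apply/orP; right; apply/subset_leq_card/fintype.subsetP => p.
  by rewrite !inE -/A => /andP[/andP[p1 p2]]; rewrite ratioE ?p1 ?p2 ?inE.
move=> C /fintype.subsetP CA sameres ratio_inj.
apply: (@separated_ratios _ C num den m) => [|a|a|a b aC bC|a b aC bC e].
- exact: ltnW.
- by move/CA/num_b.
- by move/CA/den_b.
- have cop y : y \in A -> forall i, coprime (y i) m.
    by rewrite inE => /forallP yP i; have /andP[] := yP i.
  have E y : y \in A -> (num y)%:R = (den y)%:R * recip_residue m y :> 'Z_m.
    by move/cop; apply: recip_num_Zp.
  (* With [r] the common residue, both cross products equal [den a * den b * r]. *)
  have : (num a * den b)%:R = (num b * den a)%:R :> 'Z_m.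
    by rewrite !natrM !E ?CA // (sameres a b) // mulrAC [RHS]mulrAC [_ * (den b)%:R]mulrC.
  by move/(congr1 val); rewrite /= !val_Zp_nat.
- by apply: ratio_inj => //; apply/eqP; rewrite ratioE ?CA //; apply/eqP.
Qed.

(** * Assembling the numerical bound *)

Lemma ln_nat_ge_third (R : realType) (N : nat) : (1 < N)%N -> 3^-1 <= ln N%:R :> R.
Proof.
move=> N1; have := @inv_succ_le_ln R 1 isT; rewrite ln1 subr0 => h.
apply: (@le_trans _ _ (ln 2%:R)).
  by apply: le_trans h; rewrite lef_pV2 ?posrE ?ltr0n // ler_nat.
by rewrite ler_ln ?posrE ?ltr0n ?ler_nat // ltnW.
Qed.

Theorem theorem1 (R : realType) :
  exists m0 : nat, forall m k N : nat,
    (m0 <= m)%N -> (1 < m)%N -> (0 < k)%N -> (1 < N)%N ->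
    (J m k N)%:R <
      (2 * k)%:R ^+ (90 * k ^ 3)%N * (ln N%:R) ^+ (4 * k ^ 2)%N
      * (N%:R ^+ (2 * k - 1)%N / m%:R + 1) * N%:R ^+ k :> R.
Proof.
exists 0%N => m k N _ m1 k0 N1.
have N0 : (0 < N)%N := ltnW N1.
set L := ln N%:R; set Q := N%:R ^+ (2 * k - 1) / m%:R + 1; set K : R := (2 * k)%:R.
have L3 : 3^-1 <= L := ln_nat_ge_third R N1.
have L0 : 0 < L by apply: lt_le_trans L3; rewrite invr_gt0 ltr0n.
have K2 : 2 <= K by rewrite /K ler_nat; lia.
have Q0 : 0 < Q by rewrite ltr_wpDl // divr_ge0 ?exprn_ge0.
have ratios_le : (2 * ((k * N ^ k.-1 * N ^ k) %/ m).+1)%:R <= K * Q.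
  rewrite natrM /K natrM -mulrA ler_wpM2l // /Q mulrDr mulr1.
  rewrite -natr1; apply: lerD; last by rewrite ler1n.
  rewrite mulrA ler_pdivlMr ?ltr0n; last exact: ltnW.
  rewrite -natrX -!natrM ler_nat (leq_trans (leq_divM _ _)) //.
  by rewrite -mulnA -expnD; have -> : (k.-1 + k = 2 * k - 1)%N by lia.
have posA : {in coprime_tuples m k N, forall (y : {ffun 'I_k -> 'I_N.+1}) i, 0 < y i}%N.
  by move=> y; rewrite inE => /forallP yP i; have /andP[] := yP i.
have JE := card_recip_eq R N0 posA.
apply: (@le_lt_trans _ _ (K * Q * (N%:R ^+ k * ((1 + L) ^+ (4 * k ^ 2) * 3 ^+ (8 * k ^ 3))))).
  apply: le_trans (ler_pM _ _ ratios_le JE); rewrite ?ler0n //.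
  by rewrite -natrM ler_nat; apply: J_le_recip_eq.
(* From [L >= 1/3] and [K >= 2]: [1 + L <= 4 * L <= K ^+ 2 * L]. *)
have log_le : (1 + L) ^+ (4 * k ^ 2) <= K ^+ (8 * k ^ 2) * L ^+ (4 * k ^ 2).
  have -> : (8 * k ^ 2 = 2 * (4 * k ^ 2))%N by lia.
  rewrite [K ^+ _]exprM -exprMn; apply: lerXn2r; rewrite ?nnegrE; [lra|nra|].
  have : 4 * L <= K ^+ 2 * L by rewrite ler_pM2r //; nra.
  lra.
have cube_le : 3 ^+ (8 * k ^ 3) <= K ^+ (2 * (8 * k ^ 3)).
  by rewrite [leRHS]exprM; apply: lerXn2r; rewrite ?nnegrE; nra.
(* The exponent on the left is at most [25 * k ^ 3]; the strictness of the final bound comes from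
   here. *)
have exp_lt : K ^+ (1 + 8 * k ^ 2 + 2 * (8 * k ^ 3)) < K ^+ (90 * k ^ 3).
  by rewrite ltr_eXn2l; [nia|lra].
apply: (@le_lt_trans _ _ (K ^+ (1 + 8 * k ^ 2 + 2 * (8 * k ^ 3)) *
    (L ^+ (4 * k ^ 2) * Q * N%:R ^+ k))).
  have c0 : 0 <= K * Q * N%:R ^+ k by rewrite !mulr_ge0 ?exprn_ge0 //; lra.
  have a0 : 0 <= (1 + L) ^+ (4 * k ^ 2) by rewrite exprn_ge0 //; lra.
  have b0 : 0 <= 3 ^+ (8 * k ^ 3) :> R by rewrite exprn_ge0.
  move: (ler_wpM2l c0 (ler_pM a0 b0 log_le cube_le)).
  move: (4 * k ^ 2)%N (8 * k ^ 2)%N (8 * k ^ 3)%N => a b c.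
  rewrite -[X in X <= _]mulrA => /le_trans; apply.
  rewrite [K ^+ (1 + b + _)]exprD [K ^+ (1 + b)]exprD expr1.
  rewrite le_eqVlt; apply/orP; left; apply/eqP.
  move: (K ^+ b) (K ^+ (2 * c)) (L ^+ a) (N%:R ^+ k) => x y z w.
  by ring.
by rewrite -!mulrA ltr_pM2r // !mulr_gt0 ?exprn_gt0 ?ltr0n.
Qed.
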